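(* Let $G_1$ and $G_2$ be finite simple graphs with the same number of vertices, and let $U=(u_{a,x})_{a\in V(G_2),x\in V(G_1)}$ be a bi-unitary matrix with entries in a nonzero unital $C^*$-algebra which satisfies the orthogonality conditions for the pair $(G_1,G_2)$. Then there exist a finite set $\Lambda$, a family $(G_1^\lambda)_{\lambda\in\Lambda}$ of regular induced subgraphs of $G_1$ and a family $(G_2^\lambda)_{\lambda\in\Lambda}$ of regular induced subgraphs of $G_2$ such that: (i) the degrees of vertices in $G_1^\lambda$ and $G_2^\lambda$ coincide for all $\lambda\in\Lambda$; (ii) $|V(G_1^\lambda)|=|V(G_2^\lambda)|$ for all $\lambda\in\Lambda$; (iii) after an appropriate ordering of the vertices of $G_1$ and $G_2$ (and of the corresponding columns and rows of $U$), the matrix $U$ takes the form $U=\mathrm{diag}(U_\lambda)_{\lambda\in\Lambda}$, where the sets $V(G_1^\lambda)$, $\lambda\in\Lambda$, partition $V(G_1)$, the sets $V(G_2^\lambda)$, $\lambda\in\Lambda$, partition $V(G_2)$, and each block $U_\lambda=(u_{a,x})_{a\in V(G_2^\lambda),x\in V(G_1^\lambda)}$ is a bi-unitary matrix of size $n_\lambda=|V(G_1^\lambda)|=|V(G_2^\lambda)|$ which satisfies the orthogonality conditions for the pair $(G_1^\lambda,G_2^\lambda)$.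
   Context: A finite simple graph is undirected, with no loops or multiple edges; $x\sim y$ means adjacency, and $x\not\sim x$ for every vertex. A graph is regular if all its vertices have the same degree. The subgraph of $G$ induced by $S\subset V(G)$ has vertex set $S$, two vertices being adjacent iff they are adjacent in $G$. For a unital $C^*$-algebra $\mathcal B$ and graphs $H_1,H_2$ with the same number $m$ of vertices, a matrix $W=(w_{a,x})_{a\in V(H_2),x\in V(H_1)}$ with entries in $\mathcal B$ is a bi-unitary if both $W$ and its transpose $W^t$ (entries transposed, without taking adjoints) are unitary in $M_m(\mathcal B)$. It satisfies the orthogonality conditions for the pair $(H_1,H_2)$ if $w_{a,x}w_{b,y}^*=0$ whenever ($a\sim b$ in $H_2$ and $x\not\sim y$ in $H_1$) or ($a\not\sim b$ in $H_2$ and $x\sim y$ in $H_1$). *)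

(* Defs.v *)
From HB Require Import structures.
From mathcomp Require Import all_boot all_order all_algebra.
From mathcomp Require Import complex.
From mathcomp Require Import reals.
Set Implicit Arguments.
Unset Strict Implicit.
Unset Printing Implicit Defensive.
Import Order.TTheory GRing.Theory Num.Theory.
Local Open Scope ring_scope.
Local Open Scope complex_scope.

(* Nonzero unital C*-algebras over the complex numbers R[i]: algType extends
   nzRingType, hence 1 != 0.  The norm and its completeness are fields because
   Hierarchy Builder refuses to join algType with normedModType (it reports a
   missing join of their ancestors below numDomainType). *)
HB.mixin Record Algebra_isCStar (R : realType) A of GRing.Algebra R[i] A := {
  star : A -> A;
  starK : involutive star;
  starD : {morph star : a b / a + b};
  starZ : forall (c : R[i]) (a : A), star (c *: a) = Num.conj c *: star a;
  starM : forall a b : A, star (a * b) = star b * star a;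
  cnorm : A -> R;
  cnorm0_eq0 : forall a : A, cnorm a = 0 -> a = 0;
  ler_cnormD : forall a b : A, cnorm (a + b) <= cnorm a + cnorm b;
  cnormZ : forall (c : R[i]) (a : A), (cnorm (c *: a))%:C = `|c| * (cnorm a)%:C;
  ler_cnormM : forall a b : A, cnorm (a * b) <= cnorm a * cnorm b;
  cnorm_starM : forall a : A, cnorm (star a * a) = cnorm a ^+ 2;
  cnorm_complete : forall u : nat -> A,
    (forall e : R, 0 < e -> exists N, forall m n,
      (N <= m)%N -> (N <= n)%N -> cnorm (u m - u n) < e) ->
    exists l, forall e : R, 0 < e -> exists N, forall n,
      (N <= n)%N -> cnorm (u n - l) < e
}.

#[short(type="cstarAlgType")]
HB.structure Definition CStarAlgebra (R : realType) :=
  {A of GRing.Algebra R[i] A & Algebra_isCStar R A}.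

Record sgraph := SGraph {
  vertex :> finType;
  adj : rel vertex;
  adj_sym : symmetric adj;
  adj_irrefl : irreflexive adj
}.

Definition deg (G : sgraph) (x : G) : nat := #|[set y | adj x y]|.

Definition regular (G : sgraph) : Prop := forall x y : G, deg x = deg y.

Section Induced.
Variables (G : sgraph) (S : {set G}).

Definition induced_adj : rel {x : G | x \in S} :=
  fun x y => adj (val x) (val y).

Fact induced_adj_sym : symmetric induced_adj.
Proof. by move=> x y; exact: adj_sym. Qed.

Fact induced_adj_irrefl : irreflexive induced_adj.
Proof. by move=> x; exact: adj_irrefl. Qed.

Definition induced : sgraph := SGraph induced_adj_sym induced_adj_irrefl.
End Induced.

Section Matrices.
Variables (R : realType) (B : cstarAlgType R).

(* Matrices with rows indexed by I and columns indexed by J, two finite types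
   of the same cardinality, are functions I -> J -> B; the two conditions read
   W W^* = 1 and W^* W = 1. *)
Definition unitary (I J : finType) (W : I -> J -> B) : Prop :=
  (forall a b, \sum_x W a x * star (W b x) = (a == b)%:R) /\
  (forall x y, \sum_a star (W a x) * W a y = (x == y)%:R).

Definition biunitary (I J : finType) (W : I -> J -> B) : Prop :=
  unitary W /\ unitary (fun x a => W a x).

Definition orthogonality (H1 H2 : sgraph) (W : H2 -> H1 -> B) : Prop :=
  forall (a b : H2) (x y : H1),
    (adj a b /\ ~~ adj x y) \/ (~~ adj a b /\ adj x y) ->
    W a x * star (W b y) = 0.

Definition block (G1 G2 : sgraph) (U : G2 -> G1 -> B)
    (S2 : {set G2}) (S1 : {set G1}) : induced S2 -> induced S1 -> B :=
  fun a x => U (val a) (val x).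

(* Distinct nonempty parts indexed by l. *)
Definition family_partition (k : nat) (T : finType) (V : 'I_k -> {set T}) :=
  injective V /\ partition [set V l | l : 'I_k] [set: T].

(* An ordering of T in which the elements of V l, for l = 0, ..., k - 1, occupy
   consecutive positions: tagnat.sig1 i is the block that contains position i
   of 'I_(\sum_l n l). *)
Definition block_ordering (k : nat) (n : 'I_k -> nat) (T : finType)
    (V : 'I_k -> {set T}) (e : 'I_(\sum_l n l) -> T) : Prop :=
  bijective e /\ forall i, e i \in V (tagnat.sig1 i).

(* tagnat.Rank l i is the position of the i-th index of block l. *)
Definition block_diagonal (k : nat) (I J : finType) (W : I -> J -> B)
    (V2 : 'I_k -> {set I}) (V1 : 'I_k -> {set J}) : Prop :=
  exists (n : 'I_k -> nat) (e2 : 'I_(\sum_l n l) -> I)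
         (e1 : 'I_(\sum_l n l) -> J),
    [/\ forall l, #|V2 l| = n l /\ #|V1 l| = n l,
        block_ordering V2 e2, block_ordering V1 e1 &
        \matrix_(i, j) W (e2 i) (e1 j) =
        \mxdiag_l \matrix_(i < n l, j < n l)
                    W (e2 (tagnat.Rank l i)) (e1 (tagnat.Rank l j))].
End Matrices.
Arguments block {R B G1 G2} U S2 S1 _ _.

(* Main.v *)
(** If [w_{a,x} <> 0] then [a] and [x] have equal degrees: in the sum of
    [w_{a,x} w_{b,y}^* w_{b,y}] over [b ~ a] and all [y], summing over [y] first
    gives [deg a . w_{a,x}]; in the sum over [y ~ x] and all [b], summing over
    [b] first gives [deg x . w_{a,x}]; the two agree by orthogonality.
    The blocks are the connected components of the bipartite graph in which [a]
    and [x] are joined when [w_{a,x} <> 0].  Each block is again a bi-unitary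
    satisfying the orthogonality conditions, so the degree computation applies
    inside it and makes both induced subgraphs regular of the same degree.  A
    bi-unitary is square because the sum of all [w_{a,x} w_{a,x}^*] is both the
    number of rows and the number of columns. *)
Require Import Defs.
From mathcomp Require Import all_boot all_order all_algebra.
From mathcomp Require Import complex.
From mathcomp Require Import reals.
Set Implicit Arguments.
Unset Strict Implicit.
Unset Printing Implicit Defensive.
Import GRing.Theory Num.Theory.
Local Open Scope ring_scope.

(** The slots of block [l] enumerate the fiber over [l]. Since [h] reads the block back, different
    blocks never collide, and counting [T] fiber by fiber upgrades injectivity to bijectivity. *)
Lemma block_ordering_fibers (k : nat) (T : finType) (h : T -> 'I_k)
    (n : 'I_k -> nat) : (forall l, #|[set x | h x == l]| = n l) ->
  exists e : 'I_(\sum_l n l) -> T,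
    block_ordering (fun l => [set x | h x == l]) e.
Proof.
move=> hn.
pose f (p : {l : 'I_k & 'I_(n l)}) : T :=
  enum_val (cast_ord (esym (hn (tag p))) (tagged p)).
have hf p : h (f p) = tag p.
  by have := enum_valP (cast_ord (esym (hn (tag p))) (tagged p)); rewrite inE => /eqP.
have f_inj : injective f.
  move=> [l i] [l' i'] eqf.
  have /= ll' : l = l' by have /= := congr1 h eqf; rewrite !hf.
  subst l'; move/enum_val_inj/cast_ord_inj: eqf => /= -> //.
exists (f \o tagnat.sig); split; last by move=> i; rewrite inE /= hf.
apply: bij_comp tagnat.sig_bij; apply: inj_card_bij => //.
rewrite tagnat.card -sum1_card (partition_big h xpredT) //=.
by apply: leq_sum => l _; rewrite -(hn l) -sum1dep_card.
Qed.

Lemma family_partition_fibers (k : nat) (T : finType) (h : T -> 'I_k) :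
  (forall l, exists x, h x = l) ->
  family_partition (fun l => [set x | h x == l]).
Proof.
move=> h_surj; split.
  move=> l l' /setP eql; have [x hx] := h_surj l.
  by have := eql x; rewrite !inE hx eqxx => /esym/eqP.
have -> : [set [set x | h x == l] | l : 'I_k] = preim_partition h [set: T].
  apply/setP => A; apply/imsetP/imsetP => [[l _ ->]|[x _ ->]].
    have [x hx] := h_surj l; exists x => //.
    by apply/setP => y; rewrite !inE hx eq_sym.
  by exists (h x) => //; apply/setP => y; rewrite !inE eq_sym.
exact: preim_partitionP.
Qed.

Section Components.
Variables (I J : finType) (r : I -> J -> bool).
Hypothesis r_left_total : forall a, exists x, r a x.
Hypothesis r_right_total : forall x, exists a, r a x.

(** Totality on both sides makes every component meet both [I] and [J]. The last clause is
    connectedness in the form used later: a quantity preserved along edges is constant on each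
    component. *)
Lemma bipartite_components :
  exists (k : nat) (h2 : I -> 'I_k) (h1 : J -> 'I_k),
  [/\ forall l, exists a, h2 a = l, forall l, exists x, h1 x = l,
      forall a x, r a x -> h2 a = h1 x &
      forall (f2 : I -> nat) (f1 : J -> nat),
        (forall a x, r a x -> f2 a = f1 x) ->
        forall a x, h2 a = h1 x -> f2 a = f1 x].
Proof.
pose e (u v : I + J) := match u, v with
  | inl a, inr x => r a x | inr x, inl a => r a x | _, _ => false end.
have e_sym : connect_sym e.
  by apply: sym_connect_sym => -[a|x] [b|y].
(* Each component is named by its canonical root; ranking the roots within [S] numbers the
   components. *)
pose S := [set fingraph.root e v | v : I + J].
have rootS v : fingraph.root e v \in S by apply: imset_f.
pose h v := enum_rank_in (rootS v) (fingraph.root e v).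
have hK v : enum_val (h v) = fingraph.root e v by rewrite enum_rankK_in.
have hE u v : h u = h v <-> connect e u v.
  rewrite -(rwP (fingraph.rootP e_sym)); split => [eqh|eqr].
    by rewrite -!hK eqh.
  by apply: enum_val_inj; rewrite !hK.
have h_surj l : exists v, h v = l.
  have /imsetP[v _ lv] := enum_valP l.
  by exists v; apply: enum_val_inj; rewrite hK -lv.
have hr a x : r a x -> h (inl a) = h (inr x).
  by move=> rax; apply/hE/connect1.
exists #|S|, (h \o inl), (h \o inr); split=> //.
- move=> l; have [[a|x] <-] := h_surj l; first by exists a.
  by have [a /hr] := r_right_total x; exists a.
- move=> l; have [[a|x] <-] := h_surj l; last by exists x.
  by have [x /hr] := r_left_total a; exists x.
- move=> f2 f1 fr a x /hE eax.
  (* The level set of the glued function is closed under edges, so it contains the whole component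
     of [a]. *)
  pose f v := match v with inl b => f2 b | inr y => f1 y end.
  have cl : closed e [pred v | f v == f2 a].
    by move=> [b|y] [c|z] //= /fr eqf; rewrite !inE /= eqf.
  by have := closed_connect cl eax; rewrite !inE /= eqxx => /esym/eqP.
Qed.

End Components.

Section Biunitary.
Variables (R : realType) (B : cstarAlgType R).

(** A scalar of [R[i]] that kills [1 != 0] is zero, and [R[i]] has characteristic 0. *)
Lemma cstar_natr_inj : injective (fun n : nat => n%:R : B).
Proof.
move=> m n eqmn; apply/eqP; rewrite -(eqr_nat R[i]) -subr_eq0.
have /eqP : (m%:R - n%:R : R[i]) *: (1 : B) = 0.
  by rewrite scalerBl !scaler_nat eqmn subrr.
by rewrite scaler_eq0 oner_eq0 orbF.
Qed.

Section Relations.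
Variables (I J : finType) (W : I -> J -> B).
Hypothesis W_biunitary : biunitary W.

Lemma biunitary_row_neq0 a : exists x, W a x != 0.
Proof.
have [[/(_ a a) Wa _] _] := W_biunitary.
apply/existsP; apply: contraT => /existsPn W0; move: Wa.
rewrite big1 ?eqxx => [/esym/eqP|x _]; first by rewrite oner_eq0.
by have /negPn/eqP-> := W0 x; rewrite mul0r.
Qed.

Lemma biunitary_col_neq0 x : exists a, W a x != 0.
Proof.
have [_ [/(_ x x) Wx _]] := W_biunitary.
apply/existsP; apply: contraT => /existsPn W0; move: Wx.
rewrite big1 ?eqxx => [/esym/eqP|a _]; first by rewrite oner_eq0.
by have /negPn/eqP-> := W0 a; rewrite mul0r.
Qed.

Lemma biunitary_card : #|I| = #|J|.
Proof.
have [[rows _] [cols _]] := W_biunitary.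
apply: cstar_natr_inj => /=; rewrite -!sum1_card !natr_sum.
transitivity (\sum_a \sum_x W a x * star (W a x)).
  by apply: eq_bigr => a _; rewrite rows eqxx.
by rewrite exchange_big; apply: eq_bigr => x _; rewrite cols eqxx.
Qed.

End Relations.

Lemma mulrn_deg (V : nmodType) (G : sgraph) (x : G) (c : V) :
  c *+ deg x = \sum_y c *+ adj x y.
Proof.
rewrite /deg -sumr_const big_mkcond; apply: eq_bigr => y _.
by rewrite inE; case: adj.
Qed.

Lemma biunitary_deg (H1 H2 : sgraph) (W : H2 -> H1 -> B) :
  biunitary W -> orthogonality W ->
  forall a x, W a x != 0 -> deg a = deg x.
Proof.
move=> [[_ cols] [_ rows]] W_orth a x; apply: contraNeq => deg_neq.
(* [B] may have zero divisors, but only the zero scalar kills a nonzero vector, so the degrees are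
   compared in [R[i]]. *)
suff /eqP : ((deg a)%:R - (deg x)%:R : R[i]) *: W a x = 0.
  by rewrite scaler_eq0 subr_eq0 eqr_nat (negPf deg_neq).
rewrite scalerBl !scaler_nat; apply/eqP; rewrite subr_eq0; apply/eqP.
transitivity (\sum_b \sum_y (W a x * star (W b y) * W b y) *+ adj a b).
  rewrite mulrn_deg; apply: eq_bigr => b _; rewrite sumrMnl.
  by under eq_bigr do rewrite -mulrA; rewrite -mulr_sumr rows eqxx mulr1.
transitivity (\sum_y \sum_b (W a x * star (W b y) * W b y) *+ adj x y).
  rewrite exchange_big; apply: eq_bigr => y _; apply: eq_bigr => b _.
  (* Either both multiplicities agree, or orthogonality kills the term. *)
  have [->//|neq_adj] := eqVneq (adj a b) (adj x y).
  rewrite W_orth ?mul0r ?mul0rn //.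
  by move: neq_adj; case: adj; case: adj => //; [left|right].
rewrite mulrn_deg; apply: eq_bigr => y _; rewrite sumrMnl.
by under eq_bigr do rewrite -mulrA; rewrite -mulr_sumr cols eqxx mulr1.
Qed.

Section Block.
Variables (G1 G2 : sgraph) (U : G2 -> G1 -> B).
Variables (S2 : {set G2}) (S1 : {set G1}).
Hypothesis U_supp : forall a x, U a x != 0 -> (a \in S2) = (x \in S1).

(** An entry with exactly one index in the block vanishes, so extending a sum from the block to the
    whole graph adds only zero terms; in each product the unstarred factor is the one that
    vanishes. *)
Lemma biunitary_block : biunitary U -> biunitary (block U S2 S1).
Proof.
have U0 a x : (a \in S2) != (x \in S1) -> U a x = 0.
  by apply: contraNeq => /U_supp ->.
have sumS (T : finType) (S : {set T}) (F : T -> B) :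
    (forall x, x \notin S -> F x = 0) ->
    \sum_(x : {x | x \in S}) F (val x) = \sum_x F x.
  move=> F0; rewrite -(big_sub (mem S)) /= big_mkcond.
  by apply: eq_bigr => x _; case: ifPn => // /F0->.
move=> [[c1 c2] [c3 c4]]; split; split.
- move=> a b; rewrite (sumS _ _ (fun x => U (val a) x * star (U (val b) x))) ?c1 //.
  by move=> x xS; rewrite U0 ?mul0r // (valP a) (negPf xS).
- move=> x y; rewrite (sumS _ _ (fun a => star (U a (val x)) * U a (val y))) ?c2 //.
  by move=> a aS; rewrite [X in _ * X]U0 ?mulr0 // (valP y) (negPf aS).
- move=> x y; rewrite (sumS _ _ (fun a => U a (val x) * star (U a (val y)))) ?c3 //.
  by move=> a aS; rewrite U0 ?mul0r // (valP x) (negPf aS).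
- move=> a b; rewrite (sumS _ _ (fun x => star (U (val a) x) * U (val b) x)) ?c4 //.
  by move=> x xS; rewrite [X in _ * X]U0 ?mulr0 // (valP b) (negPf xS).
Qed.

Lemma orthogonality_block : orthogonality U -> orthogonality (block U S2 S1).
Proof. by move=> U_orth a b x y; exact: U_orth. Qed.

End Block.

(** Counting in the ambient graph turns the inner degree into a function on all of [G], as the
    component argument requires. *)
Lemma deg_induced (G : sgraph) (S : {set G}) (x : induced S) :
  deg x = #|[set y in S | adj (val x) y]|.
Proof.
rewrite /deg -(card_imset _ val_inj); apply: eq_card => y.
apply/imsetP/setIdP => [[z + ->]|[yS xy]]; first by rewrite inE; case: z.
by exists (exist _ y yS); rewrite ?inE.
Qed.

Lemma block_diagonal_fibers (k : nat) (I J : finType) (W : I -> J -> B)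
    (h2 : I -> 'I_k) (h1 : J -> 'I_k) :
  (forall l, #|[set a | h2 a == l]| = #|[set x | h1 x == l]|) ->
  (forall a x, W a x != 0 -> h2 a = h1 x) ->
  block_diagonal W (fun l => [set a | h2 a == l]) (fun l => [set x | h1 x == l]).
Proof.
move=> eq_card W_supp; pose n l := #|[set x | h1 x == l]|.
have [e2 ord2] := block_ordering_fibers (n := n) eq_card.
have [e1 ord1] := block_ordering_fibers (n := n) (fun=> erefl).
exists n, e2, e1; split=> //.
apply/mxblockP => i j; apply/matrixP => s t; rewrite mxblockK !mxE.
(* On the diagonal the [conform_mx] inside [\mxdiag] is the identity; off it, a nonzero entry would
   give both blocks the same label. *)
case: eqVneq => [eqij | neqij].
  by subst j; rewrite conform_mx_id mxE.
rewrite mxE; apply: contraNeq neqij => /W_supp.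
have := ord2.2 (tagnat.Rank i s); have := ord1.2 (tagnat.Rank j t).
by rewrite !inE !tagnat.Rank1K => /eqP-> /eqP->->.
Qed.

End Biunitary.

Theorem theorem4 (R : realType) (B : cstarAlgType R) (G1 G2 : sgraph)
    (eq_card : #|G1| = #|G2|) (U : G2 -> G1 -> B)
    (U_biunitary : biunitary U) (U_orth : orthogonality U) :
  exists (k : nat) (V1 : 'I_k -> {set G1}) (V2 : 'I_k -> {set G2}),
    (forall l, regular (induced (V1 l)) /\ regular (induced (V2 l))) /\
    (forall l (x : induced (V1 l)) (a : induced (V2 l)), deg x = deg a) /\
    (forall l, #|induced (V1 l)| = #|induced (V2 l)|) /\
    family_partition V1 /\ family_partition V2 /\
    block_diagonal U V2 V1 /\
    (forall l, biunitary (block U (V2 l) (V1 l)) /\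
       orthogonality (block U (V2 l) (V1 l))).
Proof.
have [k [h2 [h1 [h2_surj h1_surj hU h_min]]]] :=
  bipartite_components (r := fun a x => U a x != 0)
    (biunitary_row_neq0 U_biunitary) (biunitary_col_neq0 U_biunitary).
pose V1 l := [set x | h1 x == l]; pose V2 l := [set a | h2 a == l].
have block_bi l : biunitary (block U (V2 l) (V1 l)).
  by apply: biunitary_block => // a x /hU; rewrite !inE => ->.
have block_orth l : orthogonality (block U (V2 l) (V1 l)).
  exact: orthogonality_block.
have card_V l : #|induced (V2 l)| = #|induced (V1 l)|.
  exact: biunitary_card (block_bi l).
have degE l (x : induced (V1 l)) (a : induced (V2 l)) : deg x = deg a.
  rewrite !deg_induced.
  case: x a => [x +] [a +] /=; rewrite !inE => /eqP hx /eqP ha.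
  rewrite -{1}hx -{1}ha; apply/esym.
  (* The preserved quantity is the degree of a vertex inside its own block, and the edge case is
     [biunitary_deg] applied to that block. *)
  apply: (h_min (fun a => #|[set b in V2 (h2 a) | adj a b]|)
                (fun x => #|[set y in V1 (h1 x) | adj x y]|)); last by rewrite ha.
  move=> {ha hx l x a} a x Uax.
  have aV : a \in V2 (h1 x) by rewrite inE (hU _ _ Uax).
  have xV : x \in V1 (h1 x) by rewrite inE.
  have := biunitary_deg (block_bi (h1 x)) (block_orth (h1 x))
    (a := exist _ a aV) (x := exist _ x xV) Uax.
  by rewrite !deg_induced /= (hU _ _ Uax).
exists k, V1, V2; split.
  move=> l; split=> [x y|a b].
    (* Regularity on one side follows by comparing both vertices with a single vertex of the other
       side. *)
    have [a ha] := h2_surj l; have aV : a \in V2 l by rewrite inE ha.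
    by rewrite !(degE l _ (exist _ a aV)).
  have [x hx] := h1_surj l; have xV : x \in V1 l by rewrite inE hx.
  by rewrite -!(degE l (exist _ x xV)).
split; first exact: degE.
split; first by move=> l; rewrite card_V.
split; first exact: family_partition_fibers.
split; first exact: family_partition_fibers.
split; last by move=> l; split.
by apply: block_diagonal_fibers => // l; have := card_V l; rewrite !card_sig.
Qed.
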